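(* Suppose $N$ is a 3-normalized Hadamard matrix of order $n\ge 4$. Then $\operatorname{ex}(N)\le \nu_n^*$, where $$\nu_n^*:=\frac{\bar\rho_n(n-3)}{2}+\frac{(n-4)(n-12)}{2\bar\rho_n}$$ and $$\bar\rho_n:=\begin{cases} 8\left\lceil \dfrac{n}{8\sqrt{n-3}}\right\rceil-4, & \text{if } n\equiv 0\pmod 8,\\[2ex] 8\left\lceil \dfrac{n}{8\sqrt{n-3}}-\dfrac12\right\rceil_+, & \text{if } n\equiv 4\pmod 8.\end{cases}$$ Equality $\operatorname{ex}(N)=\nu_n^*$ holds if and only if the last $n-3$ row sums of $N$ take only the values $\bar\rho_n\pm4$ (i.e. each of these row sums is $\bar\rho_n-4$ or $\bar\rho_n+4$).
   Context: A Hadamard matrix of order $n$ is an $n\times n$ matrix with all entries in $\{+1,-1\}$ whose rows are mutually orthogonal; if $n>2$ then $n$ is divisible by $4$. The excess $\operatorname{ex}(X)$ of a matrix $X$ is the sum of its entries; the $i$th row sum of a matrix is the sum of the entries of its $i$th row. A Hadamard matrix $N$ of order $n=4k$ is called 3-normalized if its first three rows are, in blocks of $k$ consecutive columns, $$\begin{pmatrix} +&-&-&+\\ +&-&+&-\\ +&+&-&-\end{pmatrix},$$ where $+$ and $-$ stand for the row vectors $(1,\dots,1)\in\mathbf{R}^k$ and $(-1,\dots,-1)\in\mathbf{R}^k$ respectively, and all row sums of $N$ are non-negative. $\lceil x\rceil$ denotes the least integer greater than or equal to $x$, and $\lceil x\rceil_+$ denotes the least positive integer greater than or equal to $x$. 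*)

(* Defs.v *)
From HB Require Import structures.
From mathcomp Require Import all_boot all_order all_algebra.
From mathcomp Require Import reals.

Set Implicit Arguments.
Unset Strict Implicit.
Unset Printing Implicit Defensive.

Import Order.TTheory GRing.Theory Num.Theory.
Local Open Scope ring_scope.

Definition hadamard (R : realType) (n : nat) (N : 'M[R]_n) : Prop :=
  (forall i j : 'I_n, N i j = 1 \/ N i j = -1) /\
  (forall i j : 'I_n, i != j -> \sum_(l < n) N i l * N j l = 0).

Definition row_sum (R : realType) (m n : nat) (X : 'M[R]_(m, n)) (i : 'I_m) : R :=
  \sum_(j < n) X i j.

Definition excess (R : realType) (m n : nat) (X : 'M[R]_(m, n)) : R :=
  \sum_(i < m) \sum_(j < n) X i j.

(* Entry (i, b) is the common sign, in row i, of the b-th block of n / 4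
   consecutive columns of a 3-normalized matrix. *)
Definition normal_signs (R : realType) : seq (seq R) :=
  [:: [:: 1; -1; -1;  1];
      [:: 1; -1;  1; -1];
      [:: 1;  1; -1; -1]].

(* Rows and columns are numbered from 0, so with n = 4 * k column j lies in
   block j %/ k. *)
Definition three_normalized (R : realType) (n : nat) (N : 'M[R]_n) : Prop :=
  [/\ hadamard N,
      exists k : nat, n = (4 * k)%N /\
        (forall i j : 'I_n, (i < 3)%N ->
           N i j = nth 0 (nth [::] (normal_signs R) i) (j %/ k))
    & forall i : 'I_n, 0 <= row_sum N i].

Lemma ex_pos_ge (R : realType) (x : R) :
  exists m : nat, (0 < m)%N && (x <= m%:R).
Proof.
exists (Num.bound `|x|).+1; rewrite /= (le_trans (ler_norm x)) //.
rewrite (le_trans (ltW (archi_boundP (normr_ge0 x)))) // ler_nat.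
exact: leqnSn.
Qed.

Definition ceil_pos (R : realType) (x : R) : nat := ex_minn (ex_pos_ge x).

(* Orders of 3-normalized matrices are multiples of 4, so the second branch is
   the case n = 4 %[mod 8]. *)
Definition rho_bar (R : realType) (n : nat) : R :=
  if (n %% 8 == 0)%N then
    8 * (Num.ceil (n%:R / (8 * Num.sqrt (n%:R - 3)) : R))%:~R - 4
  else
    8 * (ceil_pos (n%:R / (8 * Num.sqrt (n%:R - 3)) - 1 / 2 : R))%:R.

Definition nu_star (R : realType) (n : nat) : R :=
  rho_bar R n * (n%:R - 3) / 2 +
  (n%:R - 4) * (n%:R - 12) / (2 * rho_bar R n).

(* Main.v *)
Require Import Defs.
From mathcomp Require Import all_boot all_order all_algebra.
From mathcomp Require Import reals.
From mathcomp Require Import ring lra zify.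
Import Order.TTheory GRing.Theory Num.Theory.
Local Open Scope ring_scope.

(** The last [n - 3] row sums [s] of [N] satisfy two constraints: they are all
    congruent to [n] modulo 8 ([row_sum_mod8]), and, since the first three row
    sums vanish ([row_sum_head]), their squares add up to [n ^ 2]
    ([sum_row_sum_sqr]).  The number [rho_bar R n] is positive and is placed so
    that [rho_bar R n - 4] and [rho_bar R n + 4] are two consecutive members of
    the residue class of [n] modulo 8 ([rho_bar_class]).  Hence no [s] lies
    strictly between them, that is,
      (s - (rho - 4)) * (s - (rho + 4)) >= 0
    ([consecutive_mod8]), with equality exactly when [s] is one of the two.
    Summing over the [n - 3] rows gives
      n ^ 2 - 2 * rho * ex N + (n - 3) * (rho ^ 2 - 16) >= 0,
    and dividing by [2 * rho] gives the bound, because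
    [n ^ 2 - 16 * (n - 3) = (n - 4) * (n - 12)].  Equality in the sum means
    equality in every term.

    The argument works for every positive [rho] of the right residue class.
    Passing from [rho] to [rho + 8] improves the bound only as long as
    [rho + 4 < n / sqrt (n - 3)], where the right-hand side is the quadratic mean
    of the [n - 3] row sums; the ceilings in [rho_bar] stop at the best [rho]. *)

Lemma hadamard_row_norm {R : realType} {n : nat} {N : 'M[R]_n} (i : 'I_n) :
  hadamard N -> \sum_(l < n) N i l * N i l = n%:R.
Proof.
move=> [sgnN _]; rewrite (eq_bigr (fun=> 1)) ?sumr_const ?card_ord // => l _.
by case: (sgnN i l) => ->; rewrite ?mulrNN mulr1.
Qed.

(** Orthogonality of the rows says that [N / n] has right inverse [N^T]; as the
    matrices are square this is also a left inverse, so the columns are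
    orthogonal too and [N] multiplies the norm of the all-ones vector by
    [sqrt n]. *)
Lemma sum_row_sum_sqr {R : realType} {n : nat} {N : 'M[R]_n} :
  hadamard N -> \sum_(i < n) row_sum N i ^+ 2 = n%:R ^+ 2.
Proof.
move=> hadN; have [n0|n_gt0] := posnP n.
  by move: N hadN; rewrite n0 => N _; rewrite big_ord0 expr0n.
have n_neq0 : (n%:R : R) != 0 by rewrite pnatr_eq0 -lt0n.
have rows : N *m (n%:R^-1 *: N^T) = 1%:M.
  rewrite -scalemxAr; apply/matrixP => i j; rewrite !mxE.
  under eq_bigr do rewrite mxE.
  have [<-|neq_ij] := eqVneq i j.
    by rewrite (hadamard_row_norm i hadN) mulVf.
  by case: hadN => _ ->; rewrite // mulr0.
have cols j l : \sum_i N i j * N i l = n%:R * (j == l)%:R.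
  have /matrixP/(_ j l) := mulmx1C rows.
  rewrite -scalemxAl !mxE => <-; rewrite mulrA mulfV // mul1r.
  by apply: eq_bigr => i _; rewrite mxE.
transitivity (\sum_j \sum_l \sum_i N i j * N i l).
  under [RHS]eq_bigr do rewrite exchange_big.
  rewrite [RHS]exchange_big; apply: eq_bigr => i _.
  rewrite expr2 /row_sum mulr_suml; apply: eq_bigr => j _.
  by rewrite mulr_sumr.
transitivity (\sum_(j < n) (n%:R : R)).
  apply: eq_bigr => j _; under eq_bigr do rewrite cols.
  rewrite (bigD1 j) //= eqxx mulr1 big1 ?addr0 // => l /negPf.
  by rewrite eq_sym => ->; rewrite mulr0.
by rewrite sumr_const card_ord expr2 mulr_natr.
Qed.

Section ThreeNormalized.

Context {R : realType} {k : nat} {N : 'M[R]_(4 * k)}.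
Context (k_gt0 : (0 < k)%N) (hadN : hadamard N).
Context (headN : forall i j : 'I_(4 * k), (i < 3)%N ->
  N i j = nth 0 (nth [::] (normal_signs R) i) (j %/ k)).

Lemma head_lt (r : 'I_3) : (r < 4 * k)%N.
Proof. by have := ltn_ord r; lia. Qed.

(** The all-ones vector and the three sign rows are the four characters of the
    Klein four-group, one block for each element; their sum is 4 on the first
    block and 0 on the other three. *)
Lemma head_characters (j : 'I_(4 * k)) :
  1 + \sum_(r < 3) N (Ordinal (head_lt r)) j = 4 * (j < k)%:R.
Proof.
have: (j %/ k < 4)%N by rewrite ltn_divLR.
have -> : (j < k)%N = (j %/ k == 0)%N.
  by rewrite eqn0Ngt divn_gt0 // -ltnNge.
rewrite !big_ord_recr big_ord0 /= !headN //=.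
by case: (j %/ k)%N => [|[|[|[|q]]]] //= _; ring.
Qed.

Lemma row_sum_first_block (i : 'I_(4 * k)) :
  row_sum N i + \sum_(r < 3) \sum_l N i l * N (Ordinal (head_lt r)) l =
  4 * \sum_(l < 4 * k | (l < k)%N) N i l.
Proof.
rewrite exchange_big -big_split /= mulr_sumr [RHS]big_mkcond /=.
apply: eq_bigr => l _.
rewrite -mulr_sumr -[X in X + _]mulr1 -mulrDr head_characters.
by case: (l < k)%N; rewrite ?mulr1 ?mulr0 // mulrC.
Qed.

Lemma card_first_block : \sum_(l < 4 * k | (l < k)%N) (1 : R) = k%:R.
Proof.
rewrite -(big_ord_widen (4 * k) (fun=> 1)); last by lia.
by rewrite sumr_const card_ord.
Qed.

(** Among the three products of row [i] with the first three rows, only the one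
    with itself is nonzero; it contributes [4 * k], as does the first block, on
    which all three rows are 1. *)
Lemma row_sum_head (i : 'I_(4 * k)) : (i < 3)%N -> row_sum N i = 0.
Proof.
move=> i_lt3; have := row_sum_first_block i.
have orth (r : 'I_3) : r != Ordinal i_lt3 ->
    \sum_l N i l * N (Ordinal (head_lt r)) l = 0.
  move=> neq_r; case: hadN => _; apply; apply: contra neq_r => /eqP eq_ir.
  by apply/eqP/val_inj; move/(congr1 val): eq_ir.
rewrite (bigD1 (Ordinal i_lt3)) //= (eq_bigr (fun=> 0) orth) big1_eq addr0.
have -> : Ordinal (head_lt (Ordinal i_lt3)) = i by apply: val_inj.
rewrite (hadamard_row_norm i hadN).
rewrite (eq_bigr (fun=> 1)) ?card_first_block => [|l l_lt_k]; last first.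
  rewrite headN // divn_small //.
  by case: (nat_of_ord i) (i_lt3) => [|[|[|]]].
by rewrite natrM => /(canRL (addrK _)); rewrite subrr.
Qed.

(** A row orthogonal to the first three has row sum four times its sum over the
    first block, which is [k] minus twice the number of its negative entries. *)
Lemma row_sum_mod8 (i : 'I_(4 * k)) : (3 <= i)%N ->
  exists m : int, row_sum N i = (4 * k)%:R + 8 * m%:~R.
Proof.
move=> i_ge3; have := row_sum_first_block i; rewrite big1 ?addr0; last first.
  move=> r _; case: hadN => _; apply; apply/eqP => /(congr1 val) /= eq_ir.
  by have := ltn_ord r; rewrite -eq_ir ltnNge i_ge3.
move=> ->; exists (- \sum_(l < 4 * k | (l < k)%N) (N i l == -1 : nat)%:Z).
have neq1N1 : (1 == -1 :> R) = false by apply/negP => /eqP; lra.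
rewrite (eq_bigr (fun l => 1 - 2 * (N i l == -1 : nat)%:Z%:~R)); last first.
  move=> l _; case: hadN => sgnN _; case: (sgnN i l) => ->; last by rewrite eqxx /=; ring.
  by rewrite neq1N1 /=; ring.
rewrite big_split /= card_first_block sumrN -mulr_sumr rmorphN rmorph_sum /=.
by rewrite natrM; ring.
Qed.

End ThreeNormalized.

(** The factor [(s - (rho - 4)) * (s - (rho + 4))] is [64 * t * (t - 1)] for the
    integer [t = m - q], and no integer lies strictly between 0 and 1. *)
Lemma consecutive_mod8 {R : realType} {a s rho : R} {m q : int} :
  s = a + 8 * m%:~R -> rho - 4 = a + 8 * q%:~R ->
  0 <= (s - (rho - 4)) * (s - (rho + 4)).
Proof.
move=> -> eq_rho.
have -> : rho = a + 8 * q%:~R + 4 by rewrite -eq_rho; ring.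
have -> : (a + 8 * m%:~R - (a + 8 * q%:~R + 4 - 4)) *
    (a + 8 * m%:~R - (a + 8 * q%:~R + 4 + 4)) =
    64 * ((m - q) * (m - q - 1))%:~R :> R.
  by rewrite rmorphM !rmorphB /=; ring.
rewrite mulr_ge0 // ler0z.
have [le_mq|lt_qm] := leP m q; first by apply: mulr_le0; lia.
by apply: mulr_ge0; lia.
Qed.

Lemma rho_bar_gt0 (R : realType) (n : nat) : (4 <= n)%N -> 0 < rho_bar R n.
Proof.
move=> n_ge4; rewrite /rho_bar; case: ifP => _.
  set x := _ / _; have x_gt0 : 0 < x.
    rewrite divr_gt0 ?mulr_gt0 ?sqrtr_gt0 ?ltr0n //; first by lia.
    by rewrite subr_gt0 ltr_nat.
  have : (1 : R) <= (Num.ceil x)%:~R by rewrite ler1z -gtz0_ge1 ceil_gt0.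
  by lra.
rewrite /ceil_pos; case: ex_minnP => m /andP[m_gt0 _] _.
by rewrite mulr_gt0 // ltr0n.
Qed.

Lemma rho_bar_class (R : realType) (k : nat) :
  exists q : int, rho_bar R (4 * k) - 4 = (4 * k)%:R + 8 * q%:~R.
Proof.
rewrite /rho_bar; case: ifPn => n_mod8.
  have -> : (4 * k = 8 * k./2)%N by lia.
  set c := Num.ceil _; exists (c - 1 - k./2%:Z).
  by rewrite !rmorphB /= natrM -pmulrn; ring.
have -> : (4 * k = 8 * k./2 + 4)%N by lia.
set c := ceil_pos _; exists (c%:Z - 1 - k./2%:Z).
by rewrite !rmorphB /= natrD natrM -!pmulrn; ring.
Qed.

Theorem theorem4p2 (R : realType) (n : nat) (N : 'M[R]_n)
    (n_ge4 : (4 <= n)%N) (hN : three_normalized N) :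
  excess N <= nu_star R n /\
  (excess N = nu_star R n <->
   forall i : 'I_n, (3 <= i)%N ->
     row_sum N i = rho_bar R n - 4 \/ row_sum N i = rho_bar R n + 4).
Proof.
case: hN => hadN [k [eq_n headN]] _; subst n.
have k_gt0 : (0 < k)%N by lia.
have rho_gt0 := rho_bar_gt0 R _ n_ge4.
have [q rho_class] := rho_bar_class R k.
rewrite /nu_star; set rho := rho_bar R (4 * k) in rho_gt0 rho_class *.
pose d i := (row_sum N i - (rho - 4)) * (row_sum N i - (rho + 4)).
have d_ge0 (i : 'I_(4 * k)) : (3 <= i)%N -> 0 <= d i.
  move=> /(row_sum_mod8 k_gt0 hadN headN)[m s_class].
  exact: consecutive_mod8 s_class rho_class.
have card_head : \sum_(i < 4 * k | (i < 3)%N) (1 : R) = 3.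
  rewrite -(big_ord_widen (4 * k) (fun=> 1)); last by lia.
  by rewrite sumr_const card_ord.
have sum_d : \sum_(i < 4 * k | (3 <= i)%N) d i =
    2 * rho * (rho * ((4 * k)%:R - 3) / 2 +
      ((4 * k)%:R - 4) * ((4 * k)%:R - 12) / (2 * rho) - excess N).
  have sum_all : \sum_i d i = (4 * k)%:R ^+ 2 - 2 * rho * excess N +
      (4 * k)%:R * (rho ^+ 2 - 16).
    rewrite -(sum_row_sum_sqr hadN) /excess mulr_sumr -sumrB.
    have -> : (4 * k)%:R * (rho ^+ 2 - 16) = \sum_(i < 4 * k) (rho ^+ 2 - 16).
      by rewrite sumr_const card_ord mulr_natl.
    rewrite -big_split /=.
    by apply: eq_bigr => i _; rewrite /d /row_sum; ring.
  have sum_head : \sum_(i < 4 * k | (i < 3)%N) d i = 3 * (rho ^+ 2 - 16).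
    rewrite -card_head mulr_suml; apply: eq_bigr => i i_lt3.
    by rewrite /d (row_sum_head k_gt0 hadN headN) //; ring.
  have := sum_all; rewrite (bigID (fun i : 'I_(4 * k) => (i < 3)%N)) /= sum_head.
  under eq_bigl do rewrite -leqNgt.
  move/(canRL (addKr _)) => ->; field.
  by rewrite gt_eqF.
have rho2_gt0 : 0 < 2 * rho by rewrite mulr_gt0.
split.
  by rewrite -subr_ge0 -(pmulr_rge0 _ rho2_gt0) -sum_d sumr_ge0.
transitivity (\sum_(i < 4 * k | (3 <= i)%N) d i = 0).
  rewrite sum_d; split => [->|/eqP]; first by rewrite subrr mulr0.
  by rewrite mulf_eq0 (gt_eqF rho2_gt0) subr_eq0 => /eqP.
split => [/eqP|s_val].
  rewrite psumr_eq0 // => /allP d0 i i_ge3.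
  have := d0 i (mem_index_enum i); rewrite i_ge3 /= mulf_eq0 !subr_eq0.
  by case/orP => /eqP; [left|right].
rewrite big1 // => i /s_val[] s_eq; rewrite /d s_eq subrr ?mul0r ?mulr0 //.
Qed.
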